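(* Let $\mathcal X\subset\mathcal P_M$ be nonempty, convex and closed, let $A$ be a real $m\times M$ matrix with $A\mathcal X\subset\mathcal P_m$, and let $g\in\mathbb R^M$. Let $\epsilon\in(0,1/4]$. Then the $\epsilon$-risk of the affine estimator $\tilde g_\epsilon$ of $g^Tx$ (defined in the context) satisfies $$\mathrm{Risk}_\epsilon(\tilde g_\epsilon;\mathcal X)\le\overline S(\epsilon)\le\vartheta(\epsilon)\,\mathrm{Risk}^*_\epsilon(\mathcal X),\qquad \vartheta(\epsilon)=\frac{2\ln(2/\epsilon)}{\ln[1/(4\epsilon)]}$$ (for $\epsilon=1/4$ one has $\vartheta(\epsilon)=+\infty$ and the second inequality is void).
   Context: $\mathcal P_k=\{y\in\mathbb R^k: y\ge0,\ \sum_i y_i=1\}$ is the simplex; $[a]_j$ denotes the $j$th coordinate of a vector $a$. Observation model: for an unknown $x\in\mathcal X$, one observes $\eta^n=(\eta_1,\dots,\eta_n)$, i.i.d. with values in $\{1,\dots,m\}$ and $P\{\eta_i=j\}=[Ax]_j$, $j=1,\dots,m$. $P_x$ denotes the distribution of $\eta^n$ associated with $x$. The aim is to estimate $g^Tx$. An estimator is a measurable function $\tilde g:\{1,\dots,m\}^n\to\mathbb R$. Risks: $\mathrm{Risk}_\epsilon(\tilde g;\mathcal X)=\inf\{\delta:\ \sup_{x\in\mathcal X}P_x\{|\tilde g(\eta^n)-g^Tx|>\delta\}<\epsilon\}$ and $\mathrm{Risk}^*_\epsilon(\mathcal X)=\inf_{\tilde g}\mathrm{Risk}_\epsilon(\tilde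 g;\mathcal X)$, the infimum being over all estimators. Optimization problem: $$\overline S(\epsilon)=\max_{x,y\in\mathcal X}\Big\{\tfrac12g^T(y-x):\ h(x,y;\epsilon)\equiv n\ln\Big(\sum_{j=1}^m\sqrt{[Ax]_j[Ay]_j}\Big)+\ln(2/\epsilon)\ge0\Big\}.$$ Let $(\bar x,\bar y)$ be an optimal solution and let $\nu\ge0$ be the Lagrange multiplier of the constraint $h(x,y;\epsilon)\ge0$. Put $$\bar c=\tfrac12g^T[\bar y+\bar x],\qquad \bar\varphi_j=\nu n\ln\Big[\sqrt{[A\bar y]_j/[A\bar x]_j}\Big],\quad j=1,\dots,m.$$ The estimator is $$\tilde g_\epsilon(\eta^n)=\sum_{k=1}^m\bar\varphi_k\tilde P_n(k)+\bar c,\qquad \tilde P_n(k)=\frac1n\sum_{i=1}^n\mathbf 1(\eta_i=k).$$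
   Formalization: The formula for φ̄_j is undefined when [Ax̄]_j=[Aȳ]_j=0, and no fixed convention there makes the claim true; the theorem instead asserts that some values of φ̄_j at those letters (formula used at all others) give Risk ≤ S̄(ε). *)

(* Defs.v *)
From HB Require Import structures.
From mathcomp Require Import all_boot all_order all_algebra.
From mathcomp Require Import all_classical all_reals all_analysis.

Set Implicit Arguments.
Unset Strict Implicit.
Unset Printing Implicit Defensive.

Import Order.TTheory GRing.Theory Num.Theory.
Import numFieldNormedType.Exports.

Local Open Scope classical_set_scope.
Local Open Scope ring_scope.

Definition simplex (R : realType) (k : nat) : set 'cV[R]_k :=
  [set y | (forall i, 0 <= y i 0) /\ \sum_i y i 0 = 1].

(* The value g^T x of the linear form. *)
Definition linform (R : realType) (M : nat) (g x : 'cV[R]_M) : R :=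
  (g^T *m x) 0 0.

(* P_x: the law of n i.i.d. letters, each distributed according to A x.
   A sample eta_1, ..., eta_n is a finite function 'I_n -> 'I_m. *)
Definition Pr (R : realType) (m M n : nat) (A : 'M[R]_(m, M)) (x : 'cV[R]_M)
    (E : pred {ffun 'I_n -> 'I_m}) : R :=
  \sum_(eta | E eta) \prod_(i < n) (A *m x) (eta i) 0.

(* The sample space is finite and discrete, so that every function on it is
   measurable, hence an estimator. *)
Definition estimator (R : realType) (m n : nat) := {ffun 'I_n -> 'I_m} -> R.

Section Risk.
Variables (R : realType) (m M n : nat).
Variables (A : 'M[R]_(m, M)) (g : 'cV[R]_M) (X : set 'cV[R]_M) (eps : R).

Definition Risk (gt : estimator R m n) : \bar R :=
  ereal_inf [set delta%:E | delta in [set delta : R |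
    (ereal_sup
       [set (Pr A x (fun eta => delta < `|gt eta - linform g x|))%:E | x in X]
     < eps%:E)%E]].

Definition RiskStar : \bar R :=
  ereal_inf [set Risk gt | gt in [set: estimator R m n]].

End Risk.

Section Optimization.
Variables (R : realType) (m M n : nat).
Variables (A : 'M[R]_(m, M)) (g : 'cV[R]_M) (X : set 'cV[R]_M) (eps : R).

Definition objective (x y : 'cV[R]_M) : R := 2^-1 * linform g (y - x).

(* Extended-valued, with ln 0 = -oo: pairs x, y for which A x and A y have
   disjoint supports are infeasible. (The real-valued ln has ln 0 = 0.) *)
Definition h (x y : 'cV[R]_M) : \bar R :=
  (n%:R%:E * lne (\sum_(j < m) Num.sqrt ((A *m x) j 0 * (A *m y) j 0))%:E
   + (ln (2 / eps))%:E)%E.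

Definition feasible (x y : 'cV[R]_M) : Prop :=
  [/\ X x, X y & (0 <= h x y)%E].

Definition Sbar : \bar R :=
  ereal_sup [set s | exists x y, feasible x y /\ s = (objective x y)%:E].

Definition optimal (xb yb : 'cV[R]_M) : Prop :=
  feasible xb yb /\
  forall x y, feasible x y -> objective x y <= objective xb yb.

(* nu is a Lagrange multiplier of the constraint h >= 0 at the optimal solution
   (xb, yb), the constraint x, y \in X being kept explicit. For nu = 0 the
   convention 0 * -oo = 0 applies. *)
Definition multiplier (xb yb : 'cV[R]_M) (nu : R) : Prop :=
  [/\ 0 <= nu,
      (nu%:E * h xb yb = 0)%E
    & forall x y, X x -> X y ->
        ((objective x y)%:E + nu%:E * h x y
         <= (objective xb yb)%:E + nu%:E * h xb yb)%E].

End Optimization.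

Section AffineEstimator.
Variables (R : realType) (m M n : nat).
Variables (A : 'M[R]_(m, M)) (g : 'cV[R]_M) (xb yb : 'cV[R]_M) (nu : R).

Definition cbar : R := 2^-1 * linform g (yb + xb).

(* phi is a vector of coefficients phibar. The defining formula is imposed at
   every letter j except those where the ratio is 0 / 0 and the formula has no
   meaning; there phi j is not constrained. No fixed value is right at such
   letters: for X the simplex of R^3, A the identity, g = (gamma, -1, 1) with
   gamma < 1 close to 1, and n large, the first letter has probability 0 under
   both xb and yb but 1 under x = (1, 0, 0), and replacing ln(0 / 0) by 0 makes
   the risk exceed Sbar.
   If exactly one of the two probabilities is 0, then nu = 0 (at an optimal
   solution with multiplier nu) and phi j = 0 * (+-oo) is read as 0, as the
   total operations below give. *)
Definition is_phibar (phi : 'I_m -> R) : Prop :=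
  forall j, (A *m xb) j 0 != 0 \/ (A *m yb) j 0 != 0 ->
    phi j = nu * n%:R * ln (Num.sqrt ((A *m yb) j 0 / (A *m xb) j 0)).

End AffineEstimator.

Definition empirical (R : realType) (m n : nat) (eta : {ffun 'I_n -> 'I_m})
    (k : 'I_m) : R :=
  n%:R^-1 * \sum_(i < n) (eta i == k)%:R.

Definition affine_estimator (R : realType) (m n : nat) (phi : 'I_m -> R)
    (c : R) : estimator R m n :=
  fun eta => \sum_(k < m) phi k * empirical R eta k + c.

Definition vartheta (R : realType) (eps : R) : R :=
  2 * ln (2 / eps) / ln (1 / (4 * eps)).

(* Main.v *)
Require Import Defs.
From HB Require Import structures.
From mathcomp Require Import all_boot all_order all_algebra.
From mathcomp Require Import all_classical all_reals all_analysis.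
From mathcomp Require Import ring lra.
Import Order.TTheory GRing.Theory Num.Theory.
Import numFieldNormedType.Exports.
Local Open Scope classical_set_scope.
Local Open Scope ring_scope.

(** Why the theorem holds.

    Upper bound.  Let rho be the affinity sum_j sqrt(p_j q_j) of p = A xb and
    q = A yb, and let nu > 0.  Complementary slackness says rho^n = eps / 2.
    Exponentiating the maximality of the Lagrangian at (xb, yb) gives, for all
    x, y in X,
      sum_j sqrt([Ax]_j [Ay]_j)
        <= rho exp ((g(x - xb) + g(yb - y)) / (2 nu n)),
    with a left side that is concave in (x, y) and a right side that is convex.
    Since sqrt(ab) is the minimum over w > 0 of (w a + b / w) / 2, a minimax
    argument produces weights w_j > 0, one for each letter and independent of
    (x, y), such that the inequality survives when each square root is replaced
    by (w_j [Ax]_j + [Ay]_j / w_j) / 2 ([weights_ex]).  At (xb, yb) the replaced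
    inequality is an equality, so it is one letter by letter: this forces
    w_j = sqrt(q_j / p_j) unless p_j = q_j = 0, and it shows that p and q have
    the same support.  Letters with p_j = q_j = 0 may have positive probability
    under other x; there the formula for phibar is silent, and the minimax
    weight is what has to be used.  With phi_j = nu n ln w_j, Chernoff's bound
    with exponent 1 / nu on each of the two tails gives
    P_x (error > S + e) <= eps exp (- e / nu) < eps for every e > 0, S being the
    optimal value.  If nu = 0, the optimal pair maximizes g(y - x) over X * X,
    so cbar alone is within S of every g x.

    The weights are found one letter at a time ([weight_ex]), so that only a
    minimax over the half-line w > 0 is needed.  For fixed (x, y) the set of
    admissible w is an interval; two disjoint intervals would, by concavity,
    yield a point of X * X violating the hypothesis ([no_opposite_slopes]), and
    the supremum of the weights that are too small is then admissible.

    Lower bound.  Let (x, y) be feasible and lam = 1 / vartheta(eps), which is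
    at most 1.  Shrink x and y towards their midpoint z by the factor lam.  The
    objective is multiplied by lam, and by concavity the affinity of the shrunk
    pair is at least 1 - lam + lam rho(x, y) >= rho(x, y)^lam; its n-th power is
    at least (eps / 2)^lam = 2 sqrt eps.  An estimator with accuracy better than
    lam * objective would separate the shrunk pair by a test whose two error
    probabilities are below eps, which forces the affinity of the two n-sample
    laws strictly below 2 sqrt eps ([test_affinity]). *)

(** * Square roots of products and the exponential *)

Lemma sqrtr_mul_le_avg (R : realType) (w a b : R) :
  0 < w -> 0 <= a -> 0 <= b ->
  Num.sqrt (a * b) <= 2^-1 * (w * a + w^-1 * b).
Proof.
move=> w0 a0 b0.
have wi0 : 0 < w^-1 by rewrite invr_gt0.
have -> : a * b = (w * a) * (w^-1 * b) by field; rewrite gt_eqF.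
have A0 : 0 <= w * a by rewrite mulr_ge0 // ltW.
have B0 : 0 <= w^-1 * b by rewrite mulr_ge0 // ltW.
rewrite sqrtrM //.
have := sqr_ge0 (Num.sqrt (w * a) - Num.sqrt (w^-1 * b)).
rewrite sqrrB !sqr_sqrtr //; lra.
Qed.

(** Stated without division so that it also covers a = 0, where it gives
    b = 0. *)
Lemma avg_eq_sqrtr_mul (R : realType) (w a b : R) :
  0 < w -> 0 <= a -> 0 <= b ->
  2^-1 * (w * a + w^-1 * b) = Num.sqrt (a * b) -> w ^+ 2 * a = b.
Proof.
move=> w0 a0 b0 e.
have wi0 : 0 < w^-1 by rewrite invr_gt0.
suff -> : b = w * (w^-1 * b).
  have : (w * a - w^-1 * b) ^+ 2 = 0.
    have -> : (w * a - w^-1 * b) ^+ 2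
        = 4 * (2^-1 * (w * a + w^-1 * b)) ^+ 2 - 4 * (a * b).
      by field; rewrite gt_eqF.
    by rewrite e sqr_sqrtr ?mulr_ge0 // subrr.
  by move/eqP; rewrite sqrf_eq0 subr_eq0 => /eqP <-; ring.
by field; rewrite gt_eqF.
Qed.

(** The geometric mean is concave because the cross term a d + b c dominates
    2 sqrt(ab) sqrt(cd). *)
Lemma sqrtr_mul_concave (R : realType) (t a b c d : R) :
  0 <= t <= 1 -> 0 <= a -> 0 <= b -> 0 <= c -> 0 <= d ->
  (1 - t) * Num.sqrt (a * b) + t * Num.sqrt (c * d)
  <= Num.sqrt (((1 - t) * a + t * c) * ((1 - t) * b + t * d)).
Proof.
move=> /andP[t0 t1] a0 b0 c0 d0.
have s0 : 0 <= 1 - t by lra.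
have st0 := mulr_ge0 s0 t0.
rewrite -[leLHS]ger0_norm; last by rewrite addr_ge0 // mulr_ge0 // sqrtr_ge0.
rewrite -sqrtr_sqr ler_sqrt; last first.
  by rewrite mulr_ge0 // addr_ge0 // mulr_ge0.
have mixed : 2 * (Num.sqrt (a * b) * Num.sqrt (c * d)) <= a * d + b * c.
  have ad0 := mulr_ge0 a0 d0; have bc0 := mulr_ge0 b0 c0.
  rewrite -sqrtrM ?mulr_ge0 //.
  have -> : a * b * (c * d) = (a * d) * (b * c) by ring.
  have := @sqrtr_mul_le_avg R 1 _ _ ltr01 ad0 bc0.
  by rewrite invr1 !mul1r; lra.
rewrite sqrrD !exprMn !sqr_sqrtr ?mulr_ge0 //.
rewrite -subr_ge0.
set X := Num.sqrt (a * b) in mixed *; set Y := Num.sqrt (c * d) in mixed *.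
have -> : ((1 - t) * a + t * c) * ((1 - t) * b + t * d) -
  ((1 - t) ^+ 2 * (a * b) + (1 - t) * X * (t * Y) *+ 2 + t ^+ 2 * (c * d))
  = (1 - t) * t * (a * d + b * c - 2 * (X * Y)) by ring.
by rewrite mulr_ge0 // subr_ge0.
Qed.

Lemma expR_convex (R : realType) (t a b : R) : 0 <= t <= 1 ->
  expR ((1 - t) * a + t * b) <= (1 - t) * expR a + t * expR b.
Proof.
move=> /andP[t0 t1]; set c := (1 - t) * a + t * b.
have tangent s : expR c * (1 + (s - c)) <= expR s.
  have -> : expR s = expR c * expR (s - c) by rewrite -expRD subrKC.
  by rewrite ler_wpM2l ?expR_ge0 // expR_ge1Dx.
have s0 : 0 <= 1 - t by lra.
apply: le_trans (lerD (ler_wpM2l s0 (tangent a)) (ler_wpM2l t0 (tangent b))).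
have -> : (1 - t) * (expR c * (1 + (a - c))) + t * (expR c * (1 + (b - c)))
  = expR c * (1 + ((1 - t) * a + t * b - c)) by ring.
by rewrite subrr addr0 mulr1.
Qed.

(** * Minimax for one weight *)

(** Ky Fan's notion of a concavelike family, which asks for intermediate points
    without any linear structure on T; here a and b must moreover be affine
    along the same points. *)
Definition concavelike (R : realType) (T : Type) (D : set T) (F a b : T -> R) :=
  forall k1 k2 (t : R), D k1 -> D k2 -> 0 <= t <= 1 ->
  exists2 k, D k &
    [/\ (1 - t) * F k1 + t * F k2 <= F k,
        a k = (1 - t) * a k1 + t * a k2 & b k = (1 - t) * b k1 + t * b k2].

Arguments concavelike {R T}.

Section OneWeight.
Variables (R : realType) (T : Type) (D : set T) (F a b : T -> R).
Hypothesis a_ge0 : forall k, D k -> 0 <= a k.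
Hypothesis cvxD : concavelike D F a b.
Hypothesis F_sqrt : forall k, D k -> F k + Num.sqrt (a k * b k) <= 0.

Definition gap (w : R) (k : T) : R := F k + 2^-1 * (w * a k + w^-1 * b k).

(** Up to positive factors, b k - w^2 a k is minus the slope at w of the convex
    function gap ^~ k.  If one point violated the inequality with negative slope
    and another with positive slope, a convex combination of the two would have
    a critical point at w, where the average (w a + b / w) / 2 is exactly
    sqrt(ab): it would violate the hypothesis on F. *)
Lemma no_opposite_slopes (w : R) k1 k2 : 0 < w -> D k1 -> D k2 ->
  0 < gap w k1 -> 0 < gap w k2 -> w ^+ 2 * a k1 < b k1 -> ~ b k2 < w ^+ 2 * a k2.
Proof.
move=> w0 D1 D2 G1 G2 s1 s2.
pose u1 := b k1 - w ^+ 2 * a k1; pose u2 := w ^+ 2 * a k2 - b k2.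
have u10 : 0 < u1 by rewrite subr_gt0.
have u20 : 0 < u2 by rewrite subr_gt0.
have up : 0 < u1 + u2 by rewrite addr_gt0.
have u0 : u1 + u2 != 0 by rewrite gt_eqF.
(* t cancels the slope of the convex combination at w. *)
pose t := u1 / (u1 + u2).
have t0 : 0 <= t by rewrite divr_ge0 // ltW.
have t1 : t <= 1 by rewrite (ler_pdivrMr _ _ up) mul1r lerDl ltW.
have [|k Dk [Fk ak bk]] := cvxD k1 k2 t D1 D2; first by rewrite t0.
have critical : b k = w ^+ 2 * a k.
  apply/eqP; rewrite -subr_eq0 ak bk.
  have -> : (1 - t) * b k1 + t * b k2 - w ^+ 2 * ((1 - t) * a k1 + t * a k2)
            = (1 - t) * u1 - t * u2 by rewrite /u1 /u2; ring.
  by rewrite /t; apply/eqP; field.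
have sq : Num.sqrt (a k * b k) = w * a k.
  rewrite critical.
  have -> : a k * (w ^+ 2 * a k) = (w * a k) ^+ 2 by ring.
  by rewrite sqrtr_sqr ger0_norm // mulr_ge0 ?(ltW w0) // a_ge0.
have avg : 2^-1 * (w * a k + w^-1 * b k) = w * a k.
  by rewrite critical; field; rewrite gt_eqF.
have Gk : (1 - t) * gap w k1 + t * gap w k2 <= gap w k.
  rewrite /gap ak bk; set L := (1 - t) * _ + _ in Fk.
  have -> : (1 - t) * (F k1 + 2^-1 * (w * a k1 + w^-1 * b k1)) +
    t * (F k2 + 2^-1 * (w * a k2 + w^-1 * b k2)) = L + 2^-1 *
      (w * ((1 - t) * a k1 + t * a k2) + w^-1 * ((1 - t) * b k1 + t * b k2)).
    by rewrite /L; ring.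
  by rewrite lerD2r.
have := F_sqrt k Dk; rewrite sq -avg -/(gap w k) leNgt => /negP; apply.
apply: lt_le_trans Gk.
have [->|tp] := eqVneq t 0; first by rewrite subr0 mul1r mul0r addr0.
have t0' : 0 < t by rewrite lt_neqAle eq_sym tp.
apply: ltr_wpDl; last exact: mulr_gt0.
by rewrite mulr_ge0 ?subr_ge0 // ltW.
Qed.

(** Where the gap is positive its slope tells on which side of w the admissible
    weights must lie. *)
Definition too_small (w : R) :=
  0 < w /\ exists2 k, D k & 0 < gap w k /\ w ^+ 2 * a k < b k.
Definition too_large (w : R) :=
  0 < w /\ exists2 k, D k & 0 < gap w k /\ b k < w ^+ 2 * a k.

(** A weight that is too small for k stays so when decreased, because the convex
    function gap ^~ k decreases as far as its slope is negative; so the case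
    w2 <= w1 reduces to two opposite slopes at w2. *)
Lemma too_small_lt_too_large (w1 w2 : R) : too_small w1 -> too_large w2 -> w1 < w2.
Proof.
move=> [w10 [k1 D1 [G1 s1]]] [w20 [k2 D2 [G2 s2]]].
rewrite ltNge; apply/negP => w21.
have a1 := a_ge0 k1 D1.
have sq : w2 ^+ 2 * a k1 <= w2 * w1 * a k1.
  by rewrite ler_wpM2r // expr2 ler_wpM2l // ltW.
have sq' : w2 * w1 * a k1 <= w1 ^+ 2 * a k1.
  by rewrite ler_wpM2r // expr2 ler_wpM2r // ltW.
apply: (no_opposite_slopes w2 k1 k2) => //; last lra.
apply: lt_le_trans G1 _; rewrite -subr_ge0 /gap.
have -> : F k1 + 2^-1 * (w2 * a k1 + w2^-1 * b k1) -
  (F k1 + 2^-1 * (w1 * a k1 + w1^-1 * b k1))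
  = 2^-1 * ((w1 - w2) * (b k1 - w2 * w1 * a k1) / (w1 * w2)).
  by field; rewrite !gt_eqF.
have w12 : 0 <= w1 - w2 by lra.
have s12 : 0 <= b k1 - w2 * w1 * a k1 by lra.
by rewrite mulr_ge0 // divr_ge0 // mulr_ge0 // ltW.
Qed.

(** The term b k / w blows up as w tends to 0, which keeps the search for an
    admissible weight away from 0. *)
Lemma too_small_ex k : D k -> 0 < b k -> exists w, too_small w.
Proof.
move=> Dk b0; have a0 := a_ge0 k Dk; have n0 := normr_ge0 (F k).
set d := 1 + a k + 2 * `|F k| + b k.
have d0 : 0 < d by rewrite /d; lra.
have w0 : 0 < b k / d by rewrite divr_gt0.
have w1 : b k / d < 1 by rewrite ltr_pdivrMr // /d; lra.
exists (b k / d); split => //; exists k => //; set w := b k / d in w0 w1 *.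
have wd : w * d = b k by rewrite /w divfK // gt_eqF.
have dE : w * d = w + w * a k + 2 * (w * `|F k|) + w * b k by rewrite /d; ring.
have wa : 0 <= w * a k by rewrite mulr_ge0 // ltW.
have wF : 0 <= w * `|F k| by rewrite mulr_ge0 // ltW.
have wb : 0 <= w * b k by rewrite mulr_ge0 // ltW.
have FN : - `|F k| <= F k by rewrite -lerNl -normrN ler_norm.
have wFN : w * - `|F k| <= w * F k by rewrite ler_wpM2l // ltW.
split; last first.
  have : w ^+ 2 * a k <= w * a k by rewrite ler_wpM2r // expr2 ler_piMr // ltW.
  by lra.
rewrite -(pmulr_rgt0 _ w0) /gap.
have -> : w * (F k + 2^-1 * (w * a k + w^-1 * b k))
          = w * F k + 2^-1 * (w * (w * a k) + b k) by field; rewrite gt_eqF.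
have wwa : 0 <= w * (w * a k) by rewrite mulr_ge0 // ltW.
by lra.
Qed.

(** Slope 0 is excluded: there the average equals the square root. *)
Lemma slope_cases (w : R) k : 0 < w -> D k -> 0 < gap w k ->
  w ^+ 2 * a k < b k \/ b k < w ^+ 2 * a k.
Proof.
move=> w0 Dk Gp; case: (ltgtP (w ^+ 2 * a k) (b k)) => [|| e]; [by left|by right|].
have := F_sqrt k Dk; rewrite leNgt => /negP; case.
move: Gp; rewrite /gap -e.
have -> : a k * (w ^+ 2 * a k) = (w * a k) ^+ 2 by ring.
have -> : 2^-1 * (w * a k + w^-1 * (w ^+ 2 * a k)) = w * a k.
  by field; rewrite gt_eqF.
by rewrite sqrtr_sqr ger0_norm // mulr_ge0 ?(ltW w0) // a_ge0.
Qed.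

Lemma gap_continuous (w : R) k : 0 < w -> {for w, continuous (gap ^~ k)}.
Proof.
move=> w0; apply: cvgD; first exact: cvg_cst.
apply: cvgMr; apply: cvgD; first by apply: cvgMl; exact: cvg_id.
by apply: cvgMl; apply: cvgV; [rewrite gt_eqF | exact: cvg_id].
Qed.

(** The least upper bound of the weights that are too small is neither too small
    nor too large, since both conditions are open in w. *)
Lemma exact_weight_ex (w1 w2 : R) : too_small w1 -> too_large w2 ->
  exists2 w, 0 < w & forall k, D k -> gap w k <= 0.
Proof.
move=> s1 l2.
have U0 : too_small !=set0 by exists w1.
have Uub w : too_large w -> ubound too_small w.
  by move=> lw u su; exact/ltW/too_small_lt_too_large.
have supU : has_sup too_small by split=> //; exists w2; exact: Uub.
set w := sup too_small.
have w0 : 0 < w.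
  by apply: lt_le_trans (proj1 s1) _; exact: sup_upper_bound.
exists w => // k Dk; rewrite leNgt; apply/negP => Gp.
have near_pos : \forall v \near w, 0 < v /\ 0 < gap v k.
  apply: filterI; first exact: lt_nbhsr.
  exact: (cvgr_gt (gap w k) (gap_continuous w k w0)).
have slope_cvg : (fun v : R => v ^+ 2 * a k) @ w --> w ^+ 2 * a k.
  by apply: cvgMl; apply: exprn_continuous.
have [small|large] := slope_cases w k w0 Dk Gp.
- have : \forall v \near w, (0 < v /\ 0 < gap v k) /\ v ^+ 2 * a k < b k.
    by apply: filterI near_pos _; exact: (cvgr_lt (w ^+ 2 * a k) slope_cvg).
  move=> /nbhs_ballP[e /= e0 near_e].
  have [|[v0 Gv] sv] := near_e (w + e / 2).
    by rewrite /ball /= opprD addNKr normrN ger0_norm; lra.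
  suff : w + e / 2 <= w by lra.
  by apply: sup_upper_bound => //; split=> //; exists k.
- have : \forall v \near w, (0 < v /\ 0 < gap v k) /\ b k < v ^+ 2 * a k.
    by apply: filterI near_pos _; exact: (cvgr_gt (w ^+ 2 * a k) slope_cvg).
  move=> /nbhs_ballP[e /= e0 near_e].
  have [|[v0 Gv] sv] := near_e (w - e / 2).
    by rewrite /ball /= opprB addrCA subrr addr0 ger0_norm; lra.
  suff : w <= w - e / 2 by lra.
  by apply: ge_sup => //; apply: Uub; split=> //; exists k.
Qed.
End OneWeight.

(** The equivalence between a and b excludes the case where the infimum over w is
    approached only as w tends to 0 or to infinity. *)
Lemma weight_ex (R : realType) (T : Type) (D : set T) (F a b : T -> R) :
  (forall k, D k -> 0 <= a k) -> (forall k, D k -> 0 <= b k) ->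
  concavelike D F a b ->
  ((exists2 k, D k & 0 < a k) <-> (exists2 k, D k & 0 < b k)) ->
  (forall k, D k -> F k + Num.sqrt (a k * b k) <= 0) ->
  exists2 w, 0 < w & forall k, D k -> F k + 2^-1 * (w * a k + w^-1 * b k) <= 0.
Proof.
move=> a0 b0 cvxD ab F0.
have [[kb Db bp]|nb] := pselect (exists2 k, D k & 0 < b k); last first.
  exists 1 => // k Dk.
  have ak : a k = 0.
    apply/eqP; rewrite eq_le a0 // andbT leNgt; apply/negP => akp.
    by apply: nb; apply/ab; exists k.
  have bk : b k = 0.
    apply/eqP; rewrite eq_le b0 // andbT leNgt; apply/negP => bkp.
    by apply: nb; exists k.
  by have := F0 k Dk; rewrite ak bk !(mulr0, addr0, sqrtr0).
have [ka Da ap] : exists2 k, D k & 0 < a k by apply/ab; exists kb.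
have [w1 s1] := too_small_ex R T D F a b a0 kb Db bp.
(* Exchanging a and b amounts to replacing w by its inverse, and turns small
   weights into large ones. *)
have [v [v0 [k Dk [Gk sk]]]] := too_small_ex R T D F b a b0 ka Da ap.
apply: (exact_weight_ex R T D F a b a0 cvxD F0 w1 v^-1) => //.
split; first by rewrite invr_gt0.
exists k => //; split.
  by move: Gk; rewrite /gap invrK (addrC (v * b k)).
by rewrite exprVn ltr_pdivlMl // exprn_gt0.
Qed.

(** * Minimax for all letters *)

(** Square roots are replaced one letter at a time: the terms already replaced
    are affine and those still to be replaced are concave, so the remaining sum
    always meets the requirements of the one-weight lemma. *)
Lemma weights_ex (R : realType) (I : finType) (T : Type) (D : set T)
    (a b : I -> T -> R) (E : T -> R) :
  (forall j k, D k -> 0 <= a j k) -> (forall j k, D k -> 0 <= b j k) ->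
  (forall k1 k2 (t : R), D k1 -> D k2 -> 0 <= t <= 1 -> exists2 k, D k &
     [/\ E k <= (1 - t) * E k1 + t * E k2,
         forall j, a j k = (1 - t) * a j k1 + t * a j k2 &
         forall j, b j k = (1 - t) * b j k1 + t * b j k2]) ->
  (forall j, (exists2 k, D k & 0 < a j k) <-> (exists2 k, D k & 0 < b j k)) ->
  (forall k, D k -> \sum_j Num.sqrt (a j k * b j k) <= E k) ->
  exists2 w : I -> R, forall j, 0 < w j &
    forall k, D k -> \sum_j 2^-1 * (w j * a j k + (w j)^-1 * b j k) <= E k.
Proof.
move=> a0 b0 cvxD ab sqrtE.
pose term (S : seq I) (w : I -> R) j k :=
  if j \in S then 2^-1 * (w j * a j k + (w j)^-1 * b j k)
  else Num.sqrt (a j k * b j k).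
suff [w w0 wE] : exists2 w : I -> R, forall j, 0 < w j &
    forall k, D k -> \sum_j term (enum I) w j k <= E k.
  exists w => // k Dk; apply: le_trans _ (wE k Dk).
  by apply: ler_sum => j _; rewrite /term mem_enum.
elim: (enum I) => [|i S [w w0 wE]].
  by exists (fun=> 1) => // k Dk; exact: sqrtE.
have [iS|iS] := boolP (i \in S).
  exists w => // k Dk; apply: le_trans _ (wE k Dk).
  apply: ler_sum => j _; rewrite /term inE.
  by case: eqP => // ->; rewrite iS.
pose F k := \sum_(j | j != i) term S w j k - E k.
have [v v0 vE] : exists2 v, 0 < v &
    forall k, D k -> F k + 2^-1 * (v * a i k + v^-1 * b i k) <= 0.
  apply: weight_ex (a0 i) (b0 i) _ (ab i) _ => [k1 k2 t D1 D2 t01|k Dk].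
    have [k Dk [Ek ak bk]] := cvxD k1 k2 t D1 D2 t01.
    exists k => //; split=> //; case/andP: (t01) => t0 t1.
    suff : (1 - t) * (\sum_(j | j != i) term S w j k1) +
        t * (\sum_(j | j != i) term S w j k2) <= \sum_(j | j != i) term S w j k.
      rewrite /F; lra.
    rewrite !mulr_sumr -big_split /=; apply: ler_sum => j _.
    rewrite /term ak bk; case: ifP => _.
      by rewrite le_eqVlt; apply/orP; left; apply/eqP; ring.
    by apply: sqrtr_mul_concave => //; [exact: a0|exact: b0|exact: a0|exact: b0].
  have := wE k Dk; rewrite [X in X <= _ -> _](bigD1 i) //=.
  by rewrite {1}/term (negbTE iS) /F; lra.
exists (fun j => if j == i then v else w j) => [j|k Dk]; first by case: eqP.
have := vE k Dk; rewrite /F [X in _ -> X <= _](bigD1 i) //=.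
rewrite [X in _ -> X + _ <= _]/term inE !eqxx /=.
set lhs := \sum_(j | _) _; set rhs := \sum_(j | _) _.
suff -> : rhs = lhs by lra.
by apply: eq_bigr => j ji; rewrite /term inE (negbTE ji).
Qed.

(** * Samples of n independent letters *)

Lemma sum_prod_ffun (R : realType) (n : nat) (J : finType) (f : J -> R) :
  \sum_(eta : {ffun 'I_n -> J}) \prod_(i < n) f (eta i) = (\sum_j f j) ^+ n.
Proof.
by rewrite -(bigA_distr_bigA (fun=> f)) /= prodr_const card_ord.
Qed.

(** On the event, the product of exp (- (d + delta) / nu) and of all w (eta i) is
    at least 1, and its expectation factors over the sample. *)
Lemma chernoff_bound (R : realType) (m n : nat) (p w : 'I_m -> R) (nu d delta : R) :
  0 < nu -> (forall j, 0 <= p j) -> (forall j, 0 < w j) ->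
  \sum_(eta : {ffun 'I_n -> 'I_m} | delta < nu * \sum_(i < n) ln (w (eta i)) - d)
     \prod_(i < n) p (eta i)
  <= expR (- (d + delta) / nu) * (\sum_j w j * p j) ^+ n.
Proof.
move=> nu0 p0 w0; rewrite -(sum_prod_ffun _ n) mulr_sumr big_mkcond /=.
apply: ler_sum => eta _; rewrite big_split /=.
have P0 : 0 <= \prod_(i < n) p (eta i) by apply: prodr_ge0.
have W0 : 0 <= \prod_(i < n) w (eta i) by apply: prodr_ge0 => i _; exact: ltW.
case: ifP => [tail|_]; last by rewrite mulr_ge0 ?expR_ge0 // mulr_ge0.
rewrite mulrA ler_peMl //.
have -> : \prod_(i < n) w (eta i) = expR (\sum_(i < n) ln (w (eta i))).
  by rewrite expR_sum; apply: eq_bigr => i _; rewrite lnK // posrE.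
rewrite -expRD; apply: le_trans (expR_ge1Dx _); rewrite lerDl.
rewrite -(pmulr_rge0 _ nu0).
set L := \sum_(i < n) _ in tail *.
have -> : nu * (- (d + delta) / nu + L) = nu * L - d - delta.
  by field; rewrite gt_eqF.
by rewrite subr_ge0 ltW.
Qed.

Lemma sqrtr_prod (R : realType) (I : finType) (f : I -> R) :
  (forall i, 0 <= f i) -> Num.sqrt (\prod_i f i) = \prod_i Num.sqrt (f i).
Proof.
move=> f0; suff [] : Num.sqrt (\prod_i f i) = \prod_i Num.sqrt (f i) /\
                   0 <= \prod_i f i by [].
elim/big_ind2: _ => [|x1 x2 y1 y2 [<- x0] [<- y0]|i _].
- by rewrite sqrtr1.
- by rewrite sqrtrM // mulr_ge0.
- by [].
Qed.

(** A test with both error probabilities below eps makes the two laws nearly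
    singular.  The square root is bounded by a weighted average that puts the
    large weight on the law for which the observation is an error; the weight
    1 / sqrt eps balances the two contributions. *)
Lemma test_affinity (R : realType) (I : finType) (p q : I -> R) (T : pred I)
    (eps : R) :
  0 < eps -> (forall i, 0 <= p i) -> (forall i, 0 <= q i) ->
  \sum_i p i = 1 -> \sum_i q i = 1 ->
  \sum_(i | T i) p i < eps -> \sum_(i | ~~ T i) q i < eps ->
  \sum_i Num.sqrt (p i * q i) < 2 * Num.sqrt eps.
Proof.
move=> e0 p0 q0 p1 q1 pT qT; set s := Num.sqrt eps.
have s0 : 0 < s by rewrite sqrtr_gt0.
have si0 : 0 < s^-1 by rewrite invr_gt0.
have le_err : \sum_i Num.sqrt (p i * q i) <=
    \sum_(i | T i) 2^-1 * (s * q i + s^-1 * p i)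
    + \sum_(i | ~~ T i) 2^-1 * (s * p i + s^-1 * q i).
  rewrite (bigID T) /=; apply: lerD; apply: ler_sum => i _; last exact: sqrtr_mul_le_avg.
  by rewrite mulrC; exact: sqrtr_mul_le_avg.
apply: le_lt_trans le_err _; rewrite -!mulr_sumr !big_split /= -!mulr_sumr.
have pT1 : \sum_(i | ~~ T i) p i <= 1.
  by rewrite -p1 [leRHS](bigID T) /= lerDr sumr_ge0.
have qT1 : \sum_(i | T i) q i <= 1.
  by rewrite -q1 [leRHS](bigID T) /= lerDl sumr_ge0.
have ee : s^-1 * eps = s.
  have -> : eps = s ^+ 2 by rewrite sqr_sqrtr // ltW.
  by field; rewrite gt_eqF.
have := ler_wpM2l (ltW s0) pT1; have := ler_wpM2l (ltW s0) qT1.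
have : s^-1 * (\sum_(i | T i) p i) < s by rewrite -{2}ee ltr_pM2l.
have : s^-1 * (\sum_(i | ~~ T i) q i) < s by rewrite -{2}ee ltr_pM2l.
by lra.
Qed.

(** * The optimization problem *)

Lemma linformB (R : realType) (M : nat) (g x y : 'cV[R]_M) :
  linform g (x - y) = linform g x - linform g y.
Proof. by rewrite /linform mulmxBr !mxE. Qed.

Lemma linformD (R : realType) (M : nat) (g x y : 'cV[R]_M) :
  linform g (x + y) = linform g x + linform g y.
Proof. by rewrite /linform mulmxDr !mxE. Qed.

Lemma linform_conv (R : realType) (M : nat) (g x y : 'cV[R]_M) (t : R) :
  linform g ((1 - t) *: x + t *: y) = (1 - t) * linform g x + t * linform g y.
Proof. by rewrite /linform mulmxDr -!scalemxAr !mxE. Qed.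

Lemma mulmx_conv (R : realType) (m M : nat) (A : 'M[R]_(m, M))
    (x y : 'cV[R]_M) (t : R) j :
  (A *m ((1 - t) *: x + t *: y)) j 0 = (1 - t) * (A *m x) j 0 + t * (A *m y) j 0.
Proof. by rewrite mulmxDr -!scalemxAr !mxE. Qed.

Lemma convex_set_conv (R : realType) (M : nat) (X : set 'cV[R]_M)
    (x y : 'cV[R]_M) (t : R) :
  convex_set (X : set (convex_lmodType 'cV[R]_M)) -> X x -> X y ->
  0 <= t <= 1 -> X ((1 - t) *: x + t *: y).
Proof.
move=> cX Xx Xy t01.
have s01 : 0 <= 1 - t <= 1 by move: t01; lra.
rewrite -{2}(subKr 1 t); have := cX x y (Itv01 (proj1 (andP s01)) (proj2 (andP s01))).
by rewrite !inE => /(_ Xx Xy).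
Qed.

Definition affinity (R : realType) (m M : nat) (A : 'M[R]_(m, M))
    (x y : 'cV[R]_M) : R :=
  \sum_(j < m) Num.sqrt ((A *m x) j 0 * (A *m y) j 0).
Arguments affinity {R m M}.

Lemma affinity_ge0 (R : realType) (m M : nat) (A : 'M[R]_(m, M)) x y :
  0 <= affinity A x y.
Proof. by rewrite sumr_ge0 // => j _; rewrite sqrtr_ge0. Qed.

Lemma h_affinity_gt0 (R : realType) (m M n : nat) (A : 'M[R]_(m, M)) (eps : R) x y :
  0 < affinity A x y ->
  h n A eps x y = (n%:R * ln (affinity A x y) + ln (2 / eps))%:E.
Proof. by move=> r0; rewrite /h -/(affinity A x y) lne_EFin. Qed.

Lemma h_affinity_eq0 (R : realType) (m M n : nat) (A : 'M[R]_(m, M)) (eps : R) x y :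
  (0 < n)%N -> affinity A x y = 0 -> h n A eps x y = -oo%E.
Proof.
move=> n0 r0; rewrite /h -/(affinity A x y) r0 le0_lneNy //.
by rewrite gt0_muleNy ?lte_fin ?ltr0n.
Qed.

(** * Weights from the saddle point of the Lagrangian *)

Section Weights.
Variables (R : realType) (m M : nat) (A : 'M[R]_(m, M)) (g : 'cV[R]_M).
Variables (X : set 'cV[R]_M) (xb yb : 'cV[R]_M) (kappa : R).
Hypothesis X_convex : convex_set (X : set (convex_lmodType 'cV[R]_M)).
Hypothesis AX_ge0 : forall x, X x -> forall j, 0 <= (A *m x) j 0.
Hypotheses (Xxb : X xb) (Xyb : X yb).

Let p j := (A *m xb) j 0.
Let q j := (A *m yb) j 0.
Let rho := affinity A xb yb.

Hypothesis kappa_gt0 : 0 < kappa.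
Hypothesis rho_gt0 : 0 < rho.
Hypothesis lagrangian_max : forall x y, X x -> X y -> 0 < affinity A x y ->
  2^-1 * linform g (y - x) + kappa * ln (affinity A x y)
  <= 2^-1 * linform g (yb - xb) + kappa * ln rho.

Let bound x y :=
  rho * expR ((linform g (x - xb) + linform g (yb - y)) / (2 * kappa)).

(** The exponential form of the maximality of the Lagrangian also holds for pairs
    of affinity 0, where the Lagrangian is minus infinity. *)
Lemma affinity_le_bound x y : X x -> X y -> affinity A x y <= bound x y.
Proof.
move=> Xx Xy; have [r0|r0] := ltP 0 (affinity A x y); last first.
  by apply: le_trans r0 _; rewrite mulr_ge0 ?expR_ge0 // ltW.
rewrite /bound -{1}(lnK (x := affinity A x y)) ?posrE //.
rewrite -{1}(lnK (x := rho)) ?posrE // -expRD ler_expR -(ler_pM2l kappa_gt0).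
have := lagrangian_max x y Xx Xy r0; rewrite !linformB => le_lag.
set u := (_ / _).
have -> : kappa * (ln rho + u) = kappa * ln rho +
   2^-1 * (linform g x - linform g xb + (linform g yb - linform g y)).
  by rewrite /u; field; rewrite gt_eqF.
by lra.
Qed.

(** The weights come from [weights_ex]; equality at (xb, yb) identifies them.
    Setting y = yb (or x = xb) separates the variables: with s the exponent,
    it gives (P + rho) / 2 <= rho e^(s/2), where P is the weighted sum, and
    2 e^(s/2) - 1 <= e^s. *)
Lemma saddle_weights : exists w : 'I_m -> R,
  [/\ forall j, 0 < w j,
      forall j, p j != 0 \/ q j != 0 -> w j = Num.sqrt (q j / p j),
      forall x, X x ->
        \sum_j w j * (A *m x) j 0 <= rho * expR (linform g (x - xb) / kappa) &
      forall y, X y ->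
        \sum_j (w j)^-1 * (A *m y) j 0 <= rho * expR (linform g (yb - y) / kappa)].
Proof.
pose D : set ('cV[R]_M * 'cV[R]_M) := [set k | X k.1 /\ X k.2].
have [] := @weights_ex R 'I_m _ D (fun j k => (A *m k.1) j 0)
    (fun j k => (A *m k.2) j 0) (fun k => bound k.1 k.2).
- by move=> j k [/AX_ge0].
- by move=> j k [_ /AX_ge0].
- move=> [x1 y1] [x2 y2] t [Xx1 Xy1] [Xx2 Xy2] t01 /=.
  exists ((1 - t) *: x1 + t *: x2, (1 - t) *: y1 + t *: y2) => /=.
    by split; apply: convex_set_conv.
  split; [|by move=> j; exact: mulmx_conv..].
  pose e x y := (linform g (x - xb) + linform g (yb - y)) / (2 * kappa).
  rewrite /bound -!/(e _ _).
  have -> : e ((1 - t) *: x1 + t *: x2) ((1 - t) *: y1 + t *: y2)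
            = (1 - t) * e x1 y1 + t * e x2 y2.
    by rewrite /e !linformB !linform_conv; ring.
  have := ler_wpM2l (ltW rho_gt0) (expR_convex R t (e x1 y1) (e x2 y2) t01).
  by lra.
- move=> j; split=> -[[x y] [/= Xx Xy] aj].
    by exists (xb, x).
  by exists (y, xb).
- by move=> [x y] [/= Xx Xy]; exact: affinity_le_bound.
move=> w w0 wE; exists w.
have p0 : forall j, 0 <= p j by exact: AX_ge0.
have q0 : forall j, 0 <= q j by exact: AX_ge0.
have at_opt j : w j ^+ 2 * p j = q j.
  apply: avg_eq_sqrtr_mul => //.
  have := wE (xb, yb) (conj Xxb Xyb).
  rewrite /= /bound !linformB !subrr addr0 mul0r expR0 mulr1.
  rewrite /rho /affinity -subr_le0 -sumrB.
  move=> le0.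
  have ge0 i : 0 <= 2^-1 * (w i * p i + (w i)^-1 * q i) - Num.sqrt (p i * q i).
    by rewrite subr_ge0; exact: sqrtr_mul_le_avg.
  have /psumr_eq0P s0 : \sum_i (2^-1 * (w i * p i + (w i)^-1 * q i)
                         - Num.sqrt (p i * q i)) = 0.
    by apply/eqP; rewrite eq_le le0 sumr_ge0.
  by apply/eqP; rewrite -subr_eq0; apply/eqP/s0.
have wp j : w j * p j = Num.sqrt (p j * q j).
  rewrite -at_opt; have -> : p j * (w j ^+ 2 * p j) = (w j * p j) ^+ 2 by ring.
  by rewrite sqrtr_sqr ger0_norm // mulr_ge0 // ltW.
have wq j : (w j)^-1 * q j = Num.sqrt (p j * q j).
  by rewrite -wp -at_opt; field; rewrite gt_eqF.
have le_expR2 (s u : R) : 2^-1 * (u + rho) <= rho * expR (s / (2 * kappa)) ->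
    u <= rho * expR (s / kappa).
  have -> : s / kappa = s / (2 * kappa) + s / (2 * kappa).
    by field; rewrite gt_eqF.
  rewrite expRD; set e := expR _ => le_u.
  have := mulr_ge0 (ltW rho_gt0) (sqr_ge0 (e - 1)).
  have -> : rho * (e - 1) ^+ 2 = rho * (e * e) - 2 * (rho * e) + rho by ring.
  by lra.
split=> [//|j pq|x Xx|y Xy].
- have pj : p j != 0.
    case: pq => // qj; apply: contraNneq qj => pj.
    by rewrite -at_opt pj mulr0.
  by rewrite -at_opt mulfK // sqrtr_sqr gtr0_norm.
- apply: le_expR2; have := wE (x, yb) (conj Xx Xyb).
  rewrite /= /bound (linformB _ _ g yb yb) subrr addr0.
  apply: le_trans; rewrite -mulr_sumr big_split /= ler_wpM2l // lerD2l.
  by rewrite /rho /affinity; apply/ler_sum => j _; rewrite -wq.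
- apply: le_expR2; have := wE (xb, y) (conj Xxb Xy).
  rewrite /= /bound (linformB _ _ g xb xb) subrr add0r.
  apply: le_trans; rewrite -mulr_sumr big_split /= ler_wpM2l // [leLHS]addrC lerD2r.
  by rewrite /rho /affinity; apply/ler_sum => j _; rewrite -wp.
Qed.
End Weights.

(** * Risk of the affine estimator *)

Lemma affine_estimatorE (R : realType) (m n : nat) (phi : 'I_m -> R) (c : R)
    (eta : {ffun 'I_n -> 'I_m}) :
  affine_estimator phi c eta = n%:R^-1 * \sum_(i < n) phi (eta i) + c.
Proof.
rewrite /affine_estimator; congr (_ + _).
under eq_bigr => k _ do rewrite /empirical mulrCA mulr_sumr.
rewrite -mulr_sumr exchange_big /=; congr (_ * _); apply: eq_bigr => i _.
rewrite (bigD1 (eta i)) //= eqxx mulr1 big1 ?addr0 // => k ki.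
by rewrite eq_sym (negbTE ki) mulr0.
Qed.

(** The risk asks for a supremum strictly below eps, whence a uniform bound B. *)
Lemma Risk_le (R : realType) (m M n : nat) (A : 'M[R]_(m, M)) (g : 'cV[R]_M)
    (X : set 'cV[R]_M) (eps : R) (gt : estimator R m n) (delta B : R) :
  B < eps ->
  (forall x, X x -> Pr A x (fun eta => delta < `|gt eta - linform g x|) <= B) ->
  (Risk A g X eps gt <= delta%:E)%E.
Proof.
move=> Beps PB; apply: ereal_inf_lbound; exists delta => //=.
apply: le_lt_trans (_ : _ <= B%:E)%E _; last by rewrite lte_fin.
by apply: ge_ereal_sup => _ [x Xx <-]; rewrite lee_fin; exact: PB.
Qed.

Section UpperBound.
Variables (R : realType) (m M n : nat) (A : 'M[R]_(m, M)) (g : 'cV[R]_M).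
Variables (X : set 'cV[R]_M) (eps : R) (xb yb : 'cV[R]_M) (nu : R).
Hypothesis n_gt0 : (0 < n)%N.
Hypothesis X_convex : convex_set (X : set (convex_lmodType 'cV[R]_M)).
Hypothesis AX_ge0 : forall x, X x -> forall j, 0 <= (A *m x) j 0.
Hypothesis eps_gt0 : 0 < eps.
Hypothesis opt : optimal n A g X eps xb yb.
Hypothesis mult : multiplier n A g X eps xb yb nu.

(** With zero multiplier the pair (xb, yb) maximizes g(y - x), so g ranges
    over X between g xb and g yb, and no observation is needed. *)
Lemma risk_multiplier0 : nu = 0 -> exists2 phi : 'I_m -> R,
  is_phibar n A xb yb nu phi &
  (Risk A g X eps (@affine_estimator R m n phi (cbar g xb yb))
   <= (objective g xb yb)%:E)%E.
Proof.
case: opt => -[Xxb Xyb _] _; case: mult => _ _ lag nu0.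
exists (fun=> 0); first by move=> j _; rewrite nu0 !mul0r.
apply: (@Risk_le _ _ _ _ _ _ _ _ _ _ 0 eps_gt0) => x Xx.
rewrite /Pr big_pred0 // => eta; apply/negbTE; rewrite -leNgt.
have lagx y : X y -> linform g (y - x) <= linform g (yb - xb).
  move=> Xy; have := lag x y Xx Xy.
  by rewrite nu0 !mul0e !adde0 lee_fin /objective ler_pM2l.
have lagy y : X y -> linform g (x - y) <= linform g (yb - xb).
  move=> Xy; have := lag y x Xy Xx.
  by rewrite nu0 !mul0e !adde0 lee_fin /objective ler_pM2l.
have := lagx yb Xyb; have := lagy xb Xxb.
rewrite affine_estimatorE big1 // mulr0 add0r /cbar /objective !linformB linformD.
by rewrite ler_norml => gx gy; apply/andP; split; lra.
Qed.

Lemma affinity_at_optimum : 0 < nu ->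
  0 < affinity A xb yb /\ affinity A xb yb ^+ n = eps / 2.
Proof.
move=> nu0; case: mult => _ slack _.
have [r0|r0] := ltP 0 (affinity A xb yb); last first.
  move: slack; rewrite h_affinity_eq0 //; last first.
    by apply/le_anti; rewrite r0 affinity_ge0.
  by rewrite gt0_muleNy.
split=> //; move: slack; rewrite h_affinity_gt0 // -EFinM => -[].
move/eqP; rewrite mulf_eq0 gt_eqF //= addr_eq0 => /eqP lnr.
rewrite -[affinity A xb yb]lnK ?posrE // -expRM_natl lnr -lnV ?posrE ?divr_gt0 //.
by rewrite invf_div lnK // posrE divr_gt0.
Qed.

Lemma lagrangian_at_optimum x y : 0 < nu -> X x -> X y -> 0 < affinity A x y ->
  2^-1 * linform g (y - x) + nu * n%:R * ln (affinity A x y)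
  <= 2^-1 * linform g (yb - xb) + nu * n%:R * ln (affinity A xb yb).
Proof.
move=> nu0 Xx Xy r0; case: mult => _ _ lag.
have [rb0 _] := affinity_at_optimum nu0.
have := lag x y Xx Xy; rewrite !h_affinity_gt0 // -!EFinM -!EFinD lee_fin.
by rewrite /objective; lra.
Qed.

(** Each tail of the error is bounded by Chernoff's inequality, with the weights
    w for overestimation and their inverses for underestimation; rho^n = eps / 2
    makes each bound half of what is allowed. *)
Lemma risk_multiplier_gt0 : 0 < nu -> exists2 phi : 'I_m -> R,
  is_phibar n A xb yb nu phi &
  (Risk A g X eps (@affine_estimator R m n phi (cbar g xb yb))
   <= (objective g xb yb)%:E)%E.
Proof.
move=> nu0; have [rb0 rbn] := affinity_at_optimum nu0.
case: opt => -[Xxb Xyb _] _.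
have nR : 0 < n%:R :> R by rewrite ltr0n.
have kappa0 : 0 < nu * n%:R by rewrite mulr_gt0.
have [w [w0 wE wx wy]] := saddle_weights _ _ _ A g X xb yb _ X_convex AX_ge0
  Xxb Xyb kappa0 rb0 (fun x y => lagrangian_at_optimum x y nu0).
exists (fun j => nu * n%:R * ln (w j)) => [j pq|]; first by rewrite wE.
set S := objective g xb yb; set c := cbar g xb yb.
(* At S itself the bounds only add up to eps, not to less than eps. *)
apply/lee_addgt0Pr => e e0.
have Bsmall : eps * expR (- e / nu) < eps.
  by rewrite gtr_pMr // expR_lt1 pmulr_llt0 ?invr_gt0 // oppr_lt0.
apply: (@Risk_le _ _ _ _ _ _ _ _ _ _ _ Bsmall) => x Xx.
have p0 := AX_ge0 x Xx.
pose s eta := \sum_(i < n) ln (w (eta i)).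
have estE eta : affine_estimator (fun j => nu * n%:R * ln (w j)) c eta
                = nu * s eta + c.
  rewrite affine_estimatorE -mulr_sumr mulrA (mulrC nu) mulrA mulVf ?mul1r //.
  by rewrite gt_eqF.
have half u d : u <= affinity A xb yb * expR (d / (nu * n%:R)) ->
    0 <= u -> forall b, b + S = d -> 
    expR (- (b + (S + e)) / nu) * u ^+ n <= eps / 2 * expR (- e / nu).
  move=> ule u0 b bE.
  have un : u ^+ n <= eps / 2 * expR (d / nu).
    apply: le_trans (lerXn2r n _ _ ule) _; rewrite ?nnegrE //.
      by rewrite mulr_ge0 ?expR_ge0 // ltW.
    rewrite exprMn rbn -expRM_natl.
    have -> : n%:R * (d / (nu * n%:R)) = d / nu by field; rewrite !gt_eqF.
    exact: lexx.
  apply: le_trans (ler_wpM2l (expR_ge0 _) un) _.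
  rewrite mulrCA -expRD -bE.
  have -> : - (b + (S + e)) / nu + (b + S) / nu = - e / nu by ring.
  exact: lexx.
have wi0 j : 0 < (w j)^-1 by rewrite invr_gt0.
have cx : linform g x - c + S = linform g (x - xb).
  by rewrite /c /S /cbar /objective !linformB linformD; field.
have cy : c - linform g x + S = linform g (yb - x).
  by rewrite /c /S /cbar /objective !linformB linformD; field.
have up := half _ _ (wx x Xx) (sumr_ge0 _ (fun j _ => mulr_ge0 (ltW (w0 j)) (p0 j)))
  _ cx.
have lo := half _ _ (wy x Xx) (sumr_ge0 _ (fun j _ => mulr_ge0 (ltW (wi0 j)) (p0 j)))
  _ cy.
have {}up := le_trans (chernoff_bound _ _ n _ _ _ _ _ nu0 p0 w0) up.
have {}lo := le_trans (chernoff_bound _ _ n _ _ _ _ _ nu0 p0 wi0) lo.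
have -> : eps * expR (- e / nu)
          = eps / 2 * expR (- e / nu) + eps / 2 * expR (- e / nu) by field.
apply: le_trans (lerD up lo).
rewrite /Pr big_mkcond [X in _ <= X + _]big_mkcond [X in _ <= _ + X]big_mkcond.
rewrite -big_split /=; apply: ler_sum => eta _.
have P0 : 0 <= \prod_(i < n) (A *m x) (eta i) 0 by apply: prodr_ge0.
have siE : \sum_(i < n) ln (w (eta i))^-1 = - s eta.
  by rewrite -sumrN; apply: eq_bigr => i _; rewrite lnV ?posrE.
rewrite estE siE -/(s eta) lter_normr.
have -> : (S + e < nu * s eta + c - linform g x)
          = (S + e < nu * s eta - (linform g x - c)) by congr (_ < _); ring.
have -> : (S + e < - (nu * s eta + c - linform g x))
          = (S + e < nu * - s eta - (c - linform g x)) by congr (_ < _); ring.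
by do 2 case: (S + e < _) => /=; lra.
Qed.
End UpperBound.

(** * Lower bound on the minimax risk *)

Section LowerBound.
Variables (R : realType) (m M n : nat) (A : 'M[R]_(m, M)) (g : 'cV[R]_M).
Variables (X : set 'cV[R]_M) (eps : R).
Hypothesis n_gt0 : (0 < n)%N.
Hypothesis X_convex : convex_set (X : set (convex_lmodType 'cV[R]_M)).
Hypothesis AX_simplex : forall x, X x -> @simplex R m (A *m x).
Hypothesis eps_gt0 : 0 < eps.
Hypothesis eps_lt : eps < 4^-1.

Lemma affinity_id x : X x -> affinity A x x = 1.
Proof.
move=> /AX_simplex[p0 p1]; rewrite -p1; apply: eq_bigr => j _.
by rewrite -expr2 sqrtr_sqr ger0_norm.
Qed.

Lemma affinity_conv x y x' y' t : X x -> X y -> X x' -> X y' -> 0 <= t <= 1 ->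
  (1 - t) * affinity A x y + t * affinity A x' y'
  <= affinity A ((1 - t) *: x + t *: x') ((1 - t) *: y + t *: y').
Proof.
move=> /AX_simplex[p0 _] /AX_simplex[q0 _] /AX_simplex[p0' _] /AX_simplex[q0' _] t01.
rewrite /affinity !mulr_sumr -big_split /=; apply: ler_sum => j _.
by rewrite !mulmx_conv; exact: sqrtr_mul_concave.
Qed.

(** An estimator more accurate than half the distance between g x and g y tests x
    against y by comparison with the midpoint of g x and g y. *)
Lemma affinity_of_accurate_estimator (gt : estimator R m n) (delta : R) x y :
  X x -> X y -> delta < objective g x y ->
  (forall z, X z -> Pr A z (fun eta => delta < `|gt eta - linform g z|) < eps) ->
  affinity A x y ^+ n < 2 * Num.sqrt eps.
Proof.
move=> Xx Xy; rewrite /objective linformB => sep acc.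
have [p0 p1] := AX_simplex x Xx; have [q0 q1] := AX_simplex y Xy.
pose c := 2^-1 * (linform g x + linform g y).
pose P (x : 'cV[R]_M) (eta : {ffun 'I_n -> 'I_m}) := \prod_(i < n) (A *m x) (eta i) 0.
have P0 z : X z -> forall eta, 0 <= P z eta.
  by move=> /AX_simplex[z0 _] eta; exact: prodr_ge0.
have P1 z : X z -> \sum_eta P z eta = 1.
  move=> /AX_simplex[_ z1].
  by rewrite (sum_prod_ffun _ n _ (fun j => (A *m z) j 0)) z1 expr1n.
have -> : affinity A x y ^+ n = \sum_eta Num.sqrt (P x eta * P y eta).
  rewrite -sum_prod_ffun; apply: eq_bigr => eta _.
  by rewrite /P -big_split /= sqrtr_prod // => i; rewrite mulr_ge0.
have sub z (E E' : pred {ffun 'I_n -> 'I_m}) : X z ->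
    (forall eta, E eta -> E' eta) -> Pr A z E <= Pr A z E'.
  move=> Xz EE'; rewrite /Pr [leLHS]big_mkcond [leRHS]big_mkcond /=.
  apply: ler_sum => eta _; case: ifP => [/EE' ->//|_].
  by case: ifP => // _; exact: P0.
apply: (@test_affinity _ _ _ _ (fun eta => c <= gt eta) _ eps_gt0 (P0 x Xx) (P0 y Xy) (P1 x Xx) (P1 y Xy)).
- apply: le_lt_trans (acc x Xx); apply: sub => // eta ceta.
  by apply: lt_le_trans (ler_norm _); move: sep ceta; rewrite /c; lra.
- apply: le_lt_trans (acc y Xy); apply: sub => // eta; rewrite -ltNge => ceta.
  rewrite -normrN; apply: lt_le_trans (ler_norm _).
  by move: sep ceta; rewrite /c; lra.
Qed.

(** The test argument is applied to the pair shrunk towards the midpoint by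
    lam = 1 / vartheta eps: this is the shrinking at which the guaranteed
    affinity, at least (eps / 2)^lam, equals the threshold 2 sqrt eps. *)
Lemma objective_le_accuracy (gt : estimator R m n) (delta : R) x y :
  feasible n A X eps x y ->
  (forall z, X z -> Pr A z (fun eta => delta < `|gt eta - linform g z|) < eps) ->
  objective g x y / vartheta eps <= delta.
Proof.
move=> [Xx Xy hxy] acc; rewrite leNgt; apply/negP => sep.
set L := ln (2 / eps); set l := ln (1 / (4 * eps)).
have e4 : 0 < 4 * eps by rewrite mulr_gt0.
have l0 : 0 < l by rewrite ln_gt0 // ltr_pdivlMr // mul1r; move: eps_lt; lra.
have lL : l <= L.
  rewrite ler_ln ?posrE ?divr_gt0 ?mulr_gt0 //.
  have -> : 1 / (4 * eps) = 4^-1 * eps^-1 by field; rewrite gt_eqF.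
  by rewrite ler_pM2r ?invr_gt0 //; lra.
have L0 : 0 < L by lra.
pose lam := (vartheta eps)^-1.
have lamE : lam = l / (2 * L) by rewrite /lam /vartheta invf_div.
have lam0 : 0 < lam by rewrite lamE divr_gt0 // mulr_gt0.
have lam1 : lam <= 1 by rewrite lamE ler_pdivrMr ?mulr_gt0 //; lra.
have lam01 : 0 <= lam <= 1 by rewrite lam1 ltW.
pose z := (1 - 2^-1) *: x + 2^-1 *: y.
have Xz : X z by apply: convex_set_conv => //; lra.
pose x' := (1 - lam) *: z + lam *: x; pose y' := (1 - lam) *: z + lam *: y.
have Xx' : X x' by exact: convex_set_conv.
have Xy' : X y' by exact: convex_set_conv.
have objE : objective g x' y' = objective g x y / vartheta eps.
  by rewrite /objective !linformB !linform_conv -/lam; ring.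
have := affinity_of_accurate_estimator gt delta x' y' Xx' Xy'.
rewrite objE => /(_ sep acc); rewrite ltNge => /negP; apply.
have [r0|r0] := ltP 0 (affinity A x y); last first.
  by move: hxy; rewrite h_affinity_eq0 // ; apply/le_anti; rewrite r0 affinity_ge0.
move: hxy; rewrite h_affinity_gt0 // lee_fin -/L => hxy.
have rho' : expR (lam * ln (affinity A x y)) <= affinity A x' y'.
  apply: le_trans (affinity_conv _ _ _ _ _ Xz Xz Xx Xy lam01).
  rewrite affinity_id // mulr1.
  have := expR_convex R lam 0 (ln (affinity A x y)) lam01.
  by rewrite mulr0 add0r expR0 mulr1 lnK ?posrE.
apply: le_trans (lerXn2r n _ _ rho'); rewrite ?nnegrE ?expR_ge0 ?affinity_ge0 //.
rewrite -expRM_natl.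
have -> : 2 * Num.sqrt eps = expR (- (lam * L)).
  have -> : lam * L = 2^-1 * l by rewrite lamE; field; rewrite gt_eqF.
  apply/eqP; rewrite -(@eqrXn2 _ 2) ?mulr_ge0 ?sqrtr_ge0 ?expR_ge0 //.
  rewrite exprMn (sqr_sqrtr (ltW eps_gt0)) -expRM_natl.
  have -> : 2%:R * - (2^-1 * l) = ln ((4 * eps)).
    by rewrite /l mul1r lnV ?posrE //; field.
  by rewrite lnK ?posrE // expr2 -natrM.
rewrite ler_expR.
have := ler_wpM2l (ltW lam0) hxy; lra.
Qed.

Lemma vartheta_gt0 : 0 < vartheta eps.
Proof.
have e4 : 0 < 4 * eps by rewrite mulr_gt0.
have e14 : 4 * eps < 1 by move: eps_lt; lra.
rewrite divr_gt0 ?mulr_gt0 // ln_gt0 ?ltr_pdivlMr ?mul1r //.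
by move: eps_lt eps_gt0; lra.
Qed.

Lemma Sbar_le_RiskStar :
  (Sbar n A g X eps <= (vartheta eps)%:E * RiskStar n A g X eps)%E.
Proof.
apply: ge_ereal_sup => _ [x [y [fxy ->]]].
have th0 := vartheta_gt0.
have -> : objective g x y = vartheta eps * (objective g x y / vartheta eps).
  by rewrite mulrC divfK // gt_eqF.
rewrite EFinM; apply: lee_wpmul2l; first by rewrite lee_fin ltW.
apply: le_ereal_inf_tmp => _ [gt _ <-]; apply: le_ereal_inf_tmp => _ [delta /= acc <-].
rewrite lee_fin; apply: (objective_le_accuracy gt delta x y fxy) => z Xz.
rewrite -lte_fin; apply: le_lt_trans acc; apply: ereal_sup_ubound; exists z => //.
Qed.
End LowerBound.

(** * Near-optimality of the affine estimator *)

Theorem theorem3p1 (R : realType) (m M n : nat) (A : 'M[R]_(m, M))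
    (g : 'cV[R]_M) (X : set 'cV[R]_M) (eps : R) :
  (0 < n)%N ->
  X `<=` @simplex R M ->
  X !=set0 ->
  convex_set (X : set (convex_lmodType 'cV[R]_M)) ->
  closed X ->
  [set A *m x | x in X] `<=` @simplex R m ->
  0 < eps <= 4^-1 ->
  (forall (xb yb : 'cV[R]_M) (nu : R),
     optimal n A g X eps xb yb ->
     multiplier n A g X eps xb yb nu ->
     exists2 phi : 'I_m -> R, is_phibar n A xb yb nu phi &
       (Risk A g X eps (@affine_estimator R m n phi (cbar g xb yb))
        <= Sbar n A g X eps)%E) /\
  (eps < 4^-1 ->
     (Sbar n A g X eps <= (vartheta eps)%:E * RiskStar n A g X eps)%E).
Proof.
move=> n0 _ _ cX _ AX /andP[e0 _].
have AXs x : X x -> @simplex R m (A *m x) by move=> Xx; apply: AX; exists x.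
split=> [xb yb nu opt mult | e4]; last exact: Sbar_le_RiskStar.
have AX0 x (Xx : X x) j : 0 <= (A *m x) j 0 by have [] := AXs x Xx.
have [phi phiE risk] : exists2 phi : 'I_m -> R, is_phibar n A xb yb nu phi &
    (Risk A g X eps (@affine_estimator R m n phi (cbar g xb yb))
     <= (objective g xb yb)%:E)%E.
  have [nu0 _ _] := mult.
  have [nuE|nuN] := eqVneq nu 0; first exact: risk_multiplier0 opt mult nuE.
  have nup : 0 < nu by rewrite lt_neqAle eq_sym nuN.
  exact: risk_multiplier_gt0 n0 cX AX0 e0 opt mult nup.
exists phi => //; apply: le_trans risk _; apply: ereal_sup_ubound.
by exists xb, yb; split=> //; case: opt.
Qed.
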